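(* Let $\{X_t\,|\,t\ge 0\}$ be a stochastically monotone, time-homogeneous real-valued Markov process, in either discrete time (all time parameters being nonnegative integers) or continuous time (all time parameters being nonnegative reals). Assume that the initial distribution (the distribution of $X_0$) is chosen so that $X_0\le X_t$ almost surely for every $t\ge 0$. Then: (i) $X_t$ is stochastically increasing in $t$, i.e. $X_s\le_{\mathrm{st}}X_t$ whenever $0\le s\le t$. (ii) For every Borel supermodular function $h:\mathbb{R}^2\to\mathbb{R}$ which is nondecreasing in its first variable and for which the expectations exist and are finite, $\mathbb{E}\,h(X_s,X_t)$ is nondecreasing in $s$ on $[0,t]$. When in addition the increment condition (defined in the context) is satisfied, the same is true for $\mathbb{E}\,h(X_s,X_t-X_{t+\delta})$ for every $\delta>0$ (whenever the expectations exist and are finite). (iii) When $h:\mathbb{R}^2\to\mathbb{R}$ is Borel and nondecreasing in both variables (not necessarily supermodular) and the expected values exist and are finite, then $\mathbb{E}\,h(X_s,X_{t+s})$ is nondecreasing in $s$ (for each $t\ge 0$). When the increment condition is satisfied, the same is true for $\mathbb{E}\,h(X_s,X_{s+t}-X_{s+t+\delta})$ for $\delta>0$. (iv) When $\mathbb{E}X_t$ exists and is finite (for all $t$), it is nondecreasing in $t$, and under the increment condition it is also concave in $t$.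
   Context: A Markov transition kernel $p(x,A)$ ($x\in\mathbb{R}$, $A\subset\mathbb{R}$ Borel) is such that $p(\cdot,A)$ is a Borel function for every Borel $A$ and $p(x,\cdot)$ is a probability measure for every $x$. It is stochastically monotone if $p(x,(y,\infty))$ is nondecreasing in $x$ for each $y\in\mathbb{R}$. It satisfies the increment condition if $p(x,(x+y,\infty))$ is nonincreasing in $x$ for each $y\in\mathbb{R}$. A discrete-time time-homogeneous Markov process is stochastically monotone (resp. satisfies the increment condition) if its one-step transition kernel does. A continuous-time time-homogeneous Markov process is stochastically monotone (resp. satisfies the increment condition) if the kernel $p^t(x,A)=\mathbb{P}_x(X_t\in A)$ does for each $t>0$. The stochastic order $X\le_{\mathrm{st}}Y$ means $\mathbb{P}(X>t)\le\mathbb{P}(Y>t)$ for all $t\in\mathbb{R}$. A function $h:\mathbb{R}^2\to\mathbb{R}$ is supermodular if $h(x_1,y_2)+h(x_2,y_1)\le h(x_1,y_1)+h(x_2,y_2)$ whenever $x_1\le x_2$ and $y_1\le y_2$. In discrete time, a sequence $(a_t)_{t\ge 0}$ is concave if $a_{t+1}-a_t$ is nonincreasing in $t$. *)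

(* Defs.v *)
From HB Require Import structures.
From mathcomp Require Import all_boot all_order all_algebra.
From mathcomp Require Import all_classical all_reals all_analysis.

Set Implicit Arguments.
Unset Strict Implicit.
Unset Printing Implicit Defensive.

Import Order.TTheory GRing.Theory Num.Theory.
Import numFieldNormedType.Exports.

Local Open Scope classical_set_scope.
Local Open Scope ring_scope.

Variant time_kind := discrete_time | continuous_time.

(* Both kinds of time are treated as subsets of R, so that a process is a
   family indexed by R of which only the members at [times K] matter. *)
Definition times (R : realType) (K : time_kind) : set R :=
  match K with
  | discrete_time => [set t | t \is a Num.nat]
  | continuous_time => [set t | 0 <= t]
  end.
Arguments times : clear implicits.

(* The lags at which the dynamics and the conditions on the kernels are
   prescribed: a single step in discrete time, every t > 0 in continuous
   time. *)
Definition lags (R : realType) (K : time_kind) : set R :=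
  match K with
  | discrete_time => [set 1]
  | continuous_time => [set t | 0 < t]
  end.
Arguments lags : clear implicits.

(* [p t x A] is the probability, starting from x, of being in A at time t.
   In discrete time the two fields say that [p n] is the n-th iterate of the
   one-step kernel [p 1]. *)
Record transition_semigroup (R : realType) (K : time_kind)
    (p : R -> R.-pker R ~> R) : Prop := {
  semigroup0 : forall (x : R) (A : set R), measurable A -> p 0 x A = \d_x A ;
  semigroupD : forall (s t x : R) (A : set R), times R K s -> times R K t ->
    measurable A -> p (s + t) x A = (\int[p s x]_y p t y A)%E }.

Definition natural_filtration d (Omega : measurableType d) (R : realType)
    (K : time_kind) (X : R -> Omega -> R) (s : R) : set (set Omega) :=
  <<s \bigcup_(u in [set u | times R K u /\ u <= s])
        preimage_set_system setT (X u) measurable >>.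

(* The field [markov_property] is
   P (X_(s + h) \in A | F_s) = p^h (X_s, A) almost surely, written out with
   the defining property of conditional expectation. *)
Record markov_process d (Omega : measurableType d) (R : realType)
    (P : probability Omega R) (K : time_kind)
    (p : R -> R.-pker R ~> R) (X : R -> {RV P >-> R}) : Prop := {
  markov_semigroup : transition_semigroup K p ;
  markov_property : forall (s h : R) (E : set Omega) (A : set R),
    times R K s -> lags R K h ->
    natural_filtration K X s E -> measurable A ->
    P (E `&` X (s + h) @^-1` A) = (\int[P]_(w in E) p h (X s w) A)%E }.

Definition kernel_monotone (R : realType) (k : R.-pker R ~> R) :=
  forall y : R, nondecreasing_fun (fun x : R => k x `]y, +oo[%classic).

Definition kernel_increment (R : realType) (k : R.-pker R ~> R) :=
  forall y : R, nonincreasing_fun (fun x : R => k x `](x + y), +oo[%classic).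

Definition stochastically_monotone (R : realType) (K : time_kind)
    (p : R -> R.-pker R ~> R) :=
  forall t : R, lags R K t -> kernel_monotone (p t).

Definition increment_condition (R : realType) (K : time_kind)
    (p : R -> R.-pker R ~> R) :=
  forall t : R, lags R K t -> kernel_increment (p t).

Definition st_le d (Omega : measurableType d) (R : realType)
    (P : probability Omega R) (X Y : {RV P >-> R}) :=
  forall t : R, (ccdf X t <= ccdf Y t)%E.

Definition supermodular (R : realType) (h : R * R -> R) :=
  forall x1 x2 y1 y2 : R, x1 <= x2 -> y1 <= y2 ->
    h (x1, y2) + h (x2, y1) <= h (x1, y1) + h (x2, y2).

Definition nondecreasing_fst (R : realType) (h : R * R -> R) :=
  forall y : R, nondecreasing_fun (fun x : R => h (x, y)).

Definition nondecreasing_snd (R : realType) (h : R * R -> R) :=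
  forall x : R, nondecreasing_fun (fun y : R => h (x, y)).

Definition finite_mean d (Omega : measurableType d) (R : realType)
    (P : probability Omega R) (Y : Omega -> R) :=
  P.-integrable setT (EFin \o Y).

(* The mean of [Y s] is compared at those s in D where it exists and is
   finite; it need not be finite at the other points of D. *)
Definition nondecreasing_mean d (Omega : measurableType d) (R : realType)
    (P : probability Omega R) (D : set R) (Y : R -> Omega -> R) :=
  forall s1 s2 : R, D s1 -> D s2 -> s1 <= s2 ->
    finite_mean P (Y s1) -> finite_mean P (Y s2) ->
    ('E_P[Y s1] <= 'E_P[Y s2])%E.

Definition concave_in_time (R : realType) (K : time_kind) (a : R -> R) :=
  match K with
  | discrete_time => forall s t : R,
      times R discrete_time s -> times R discrete_time t -> s <= t ->
      a (t + 1) - a t <= a (s + 1) - a s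
  | continuous_time =>
      convex_function (times R continuous_time) (fun t => - a t)
  end.

(* Main.v *)
Require Import Defs.
From HB Require Import structures.
From mathcomp Require Import all_boot all_order all_algebra.
From mathcomp Require Import all_classical all_reals all_analysis.
From mathcomp Require Import measurable_realfun.
From mathcomp Require Import lra.

(** Everything rests on comparing expectations of bounded nonnegative test
functions, so that no integrability question arises before the very end.

Since X_0 <= X_(t - s) almost surely, running both for a further time s with
the monotone kernel p^s gives X_s <=st X_t ([markov_st_le]).  Part (iii)
follows: for g nondecreasing in both variables, E g(X_s, X_(s + t)) is the
mean of f(X_s) with f(x) = int p^t(x, dy) g(x, y), and f is nondecreasing.

For (ii), let s1 <= s2 <= t and condition on the past up to s2: with
G(x, z) = int p^(t - s2)(z, dy) g(x, y), the two means to be compared are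
E G(X_s1, X_s2) and E G(X_s2, X_s2).  Monotonicity of the kernel makes G
supermodular again ([kernel_mean_supermodular]).  This leaves a transport
problem: among all U <=st V, the choice U = V maximizes E G(U, V)
([supermodular_rearrangement]).  As in Kantorovich duality, it is solved by a
potential, a nondecreasing phi with G(x, z) - G(z, z) <= phi(x) - phi(z)
([supermodular_potential]): integrate this at (U, V) and use
E phi(U) <= E phi(V).

Under the increment condition, X_t - X_(t + delta) is a noisy nondecreasing
function of X_t ([kernel_increment_response]); averaging over it turns the
test function g(x, X_t - X_(t + delta)) into a test function of X_s and X_t of
the same class, and the previous comparisons apply.

An unbounded h is reached by truncations whose increments are dominated by
those of h ([truncated_increment_le], [clamp_dist]): only the difference of
the two means is ever passed to the limit, and this is why the finiteness of
these two means is enough.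

Part (iv) is (iii) for the two coordinate functions: the mean is nondecreasing
and its increments over a fixed lag are nonincreasing.  In continuous time this
gives concavity on rational subdivisions of an interval, and monotonicity
extends it to the remaining points ([concave_of_increments]). *)

Set Implicit Arguments.
Unset Strict Implicit.
Unset Printing Implicit Defensive.

Import Order.TTheory GRing.Theory Num.Theory.
Import numFieldNormedType.Exports.

Local Open Scope classical_set_scope.
Local Open Scope ring_scope.

(** * A potential for supermodular functions *)

(** A discrete version of the integral of d_1 G(u, u) du: along a chain
x >= u1 >= u2 >= ... each step from u up to its predecessor x contributes
G (x, u) - G (u, u), the increment of G with the second variable frozen at the
lower end. *)
Fixpoint chain_gain (R : realType) (G : R * R -> R) (x : R) (s : seq R) : R :=
  if s is u :: s' then G (x, u) - G (u, u) + chain_gain G u s' else 0.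

Section potential.
Variables (R : realType) (G : R * R -> R) (C : R).
Hypotheses (G_sup : supermodular G) (G_fst : nondecreasing_fst G).
Hypothesis G_bound : forall z, 0 <= G z <= C.

Let gains x := [set chain_gain G x s | s in [set s | path >=%R x s]].

(** By supermodularity the increments do not decrease when their second variable
is frozen at M, above the whole chain; they then telescope. *)
Let gain_le x M s : path >=%R x s -> x <= M -> chain_gain G x s <= G (x, M).
Proof.
elim: s x => [|u s ih] x /=; first by move=> _ _; case/andP: (G_bound (x, M)).
move=> /andP[ux us] xM; have uM := le_trans ux xM.
have := ih _ us uM; have := G_sup ux uM; lra.
Qed.

Let gains_sup x : has_sup (gains x).
Proof.
split; first by exists 0, [::].
exists C => _ [s xs <-]; apply: le_trans (gain_le xs (lexx x)) _.
by case/andP: (G_bound (x, x)).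
Qed.

Let potential x := sup (gains x).

Let potential_ub x s : path >=%R x s -> chain_gain G x s <= potential x.
Proof. by move=> xs; apply: (sup_upper_bound (gains_sup x)); exists s. Qed.

Let potential_le x y : (forall s, path >=%R x s -> chain_gain G x s <= y) ->
  potential x <= y.
Proof.
move=> h; apply: ge_sup; first by exists 0, [::].
by move=> _ [s xs <-]; exact: h.
Qed.

Let potential_ge0 x : 0 <= potential x.
Proof. exact: (@potential_ub x [::]). Qed.

Let potential_up x z : z <= x -> G (x, z) - G (z, z) + potential z <= potential x.
Proof.
move=> zx; rewrite addrC -lerBrDr; apply: potential_le => s zs.
by rewrite lerBrDr addrC; apply: (@potential_ub x (z :: s)); rewrite /= zx.
Qed.

(** Inserting x in a chain that descends from w >= x does not decrease its gain;
the part below x then gains at most [potential x], and the part above telescopes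
as before. *)
Let gain_cut x M w s : path >=%R w s -> x <= w -> w <= M ->
  chain_gain G w s <= potential x + (G (w, M) - G (x, M)).
Proof.
elim: s w => [|u s ih] w /=.
  by move=> _ xw wM; have := potential_ge0 x; have := G_fst M xw; lra.
move=> /andP[uw us] xw wM.
have [xu|/ltW ux] := leP x u.
  have := ih _ us xu (le_trans uw wM); have := G_sup uw (le_trans uw wM); lra.
have /(_ _)/= := @potential_ub x (u :: s); rewrite ux us => /(_ isT).
have := G_sup xw (le_trans uw wM); lra.
Qed.

(** The potential at x is the supremum of the gains of all the chains that
descend from x.  For z <= x the inequality is the extension of a chain by one
step; for x < z it is the cut of a chain at x. *)
Lemma supermodular_potential : exists phi : R -> R,
  [/\ nondecreasing_fun phi, forall x, 0 <= phi x <= C &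
      forall x z, G (x, z) - G (z, z) <= phi x - phi z].
Proof.
exists potential; split => [x y xy|x|x z].
- by have := potential_up xy; have := G_fst x xy; lra.
- rewrite potential_ge0/=; apply: potential_le => s xs.
  by apply: le_trans (gain_le xs (lexx x)) _; case/andP: (G_bound (x, x)).
- have [zx|/ltW xz] := leP z x; first by have := potential_up zx; lra.
  suff : potential z <= potential x + (G (z, z) - G (x, z)) by lra.
  by apply: potential_le => s zs; exact: gain_cut zs xz (lexx z).
Qed.

End potential.

(** * Expectations and the usual stochastic order *)

Lemma ge0_le_integralT d (T : measurableType d) (R : realType)
    (mu : {measure set T -> \bar R}) (f g : T -> R) :
  measurable_fun setT f -> measurable_fun setT g ->
  (forall w, 0 <= f w <= g w) ->
  (\int[mu]_w (f w)%:E <= \int[mu]_w (g w)%:E)%E.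
Proof.
move=> mf mg fg; apply: ge0_le_integral => //.
- by move=> w _; rewrite lee_fin; case/andP: (fg w).
- exact/measurable_EFinP.
- exact/measurable_EFinP.
- by move=> w _; rewrite lee_fin; case/andP: (fg w).
Qed.

Section stochastic_order.
Context d d' (T : measurableType d) (T' : measurableType d') (R : realType).
Variables (P : probability T R) (Q : probability T' R).
Variables (A : {RV P >-> R}) (B : {RV Q >-> R}).
Hypothesis AB : forall y, (ccdf A y <= ccdf B y)%E.

Let closed_tail_cvg d0 (T0 : measurableType d0) (P0 : probability T0 R)
    (A0 : {RV P0 >-> R}) (a : R) :
  ccdf A0 (a - n.+1%:R^-1) @[n --> \oo] --> P0 (A0 @^-1` `[a, +oo[).
Proof.
have -> : A0 @^-1` `[a, +oo[ = \bigcap_n (A0 @^-1` `](a - n.+1%:R^-1), +oo[).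
  apply/seteqP; split => w /=; rewrite in_itv/= andbT.
    by move=> aw n _ /=; rewrite in_itv/= andbT; apply: lt_le_trans aw;
      rewrite gtrBl invr_gt0.
  move=> h; rewrite leNgt; apply/negP => wa.
  have [n] := ltr_add_invr wa; rewrite -ltrBrDr => wn.
  by have := h n Logic.I; rewrite /= in_itv/= andbT => /(lt_trans wn); rewrite ltxx.
apply: (@nonincreasing_cvg_mu _ _ _ P0
  (fun n => A0 @^-1` `](a - n.+1%:R^-1), +oo[)).
- by rewrite (le_lt_trans (probability_le1 _ _)) ?ltry//; exact: measurable_funPTI.
- by move=> n; exact: measurable_funPTI.
- by apply: bigcapT_measurable => n; exact: measurable_funPTI.
- apply/nonincreasing_seqP => n; apply/subsetPset => w /=.
  rewrite !in_itv/= !andbT; apply: le_lt_trans.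
  by rewrite lerD2l lerN2 lef_pV2 ?posrE// ler_nat.
Qed.

(** An upper set is empty, full, or a half-line; the tails of a closed half-line
are limits of those of open ones. *)
Lemma st_le_upper_set (U : set R) : (forall x y, U x -> x <= y -> U y) ->
  (P (A @^-1` U) <= Q (B @^-1` U))%E.
Proof.
move=> Uup.
have [->|/set0P[u Uu]] := eqVneq U set0; first by rewrite !preimage_set0 !measure0.
have [lbU|nlb] := pselect (has_lbound U); last first.
  suff -> : U = setT by rewrite !preimage_setT !probability_setT.
  apply/seteqP; split=> // x _; apply: contrapT => nUx; apply: nlb; exists x.
  by move=> y Uy; rewrite leNgt; apply/negP => /ltW yx; exact/nUx/(Uup y).
have infU : has_inf U by split => //; exists u.
have Ugt x : inf U < x -> U x.
  move=> ix; have e0 : 0 < x - inf U by rewrite subr_gt0.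
  have [y Uy] := inf_adherent e0 infU; rewrite addrC subrK => /ltW yx.
  exact: Uup Uy yx.
have [Ui|nUi] := pselect (U (inf U)).
  have -> : U = `[inf U, +oo[%classic.
    apply/seteqP; split=> x; rewrite /= in_itv/= andbT; first exact: ge_inf.
    exact: Uup.
  have cA := @closed_tail_cvg _ _ P A (inf U); have cB := @closed_tail_cvg _ _ Q B (inf U).
  apply: (lee_cvg_to cA cB).
  exact: nearW.
have -> : U = `]inf U, +oo[%classic.
  apply/seteqP; split=> x; rewrite /= in_itv/= andbT; last exact: Ugt.
  move=> Ux; rewrite lt_neqAle ge_inf// andbT.
  by apply/eqP => iUx; apply: nUi; rewrite iUx.
exact: AB.
Qed.

(** The tail formula E f(A) = int_0^oo P(f(A) > r) dr reduces this to the upper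
sets f > r. *)
Lemma st_le_expectation (f : R -> R) : nondecreasing_fun f ->
  (forall x, 0 <= f x) ->
  (\int[P]_w (f (A w))%:E <= \int[Q]_w (f (B w))%:E)%E.
Proof.
move=> fnd f0; have mf : measurable_fun [set: R] f by exact: nondecreasing_measurable.
have mfA : measurable_fun setT (f \o A) by exact: measurableT_comp.
have mfB : measurable_fun setT (f \o B) by exact: measurableT_comp.
pose FA := mfun_Sub (mem_set mfA) : {RV P >-> R}.
pose FB := mfun_Sub (mem_set mfB) : {RV Q >-> R}.
have EA := @ge0_expectation_ccdf _ _ _ P FA (fun x => f0 _).
have EB := @ge0_expectation_ccdf _ _ _ Q FB (fun x => f0 _).
rewrite !expectation_def in EA EB; rewrite [leLHS]EA [leRHS]EB.
apply: ge0_le_integral => //.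
- by apply: measurable_funTS; exact: ccdf_measurable.
- by apply: measurable_funTS; exact: ccdf_measurable.
- move=> r _; apply: (@st_le_upper_set (f @^-1` `]r, +oo[)).
  move=> x y /=; rewrite !in_itv/= !andbT => rx xy.
  exact: lt_le_trans rx (fnd _ _ xy).
Qed.

End stochastic_order.

(** * Disintegration along a kernel *)

Section kernel_law.
Context d d' (T : measurableType d) (S : measurableType d') (R : realType).
Variables (q : R.-pker T ~> S) (x : T).

(** The measure [q x] as a probability, so that the results on random variables
apply under it. *)
Definition kernel_law : set S -> \bar R := q x.

HB.instance Definition _ := Measure.copy kernel_law (q x).

HB.instance Definition _ :=
  Measure_isProbability.Build _ _ _ kernel_law (prob_kernel x).

End kernel_law.

Section paired_kernel.
Context d d' (T : measurableType d) (S : measurableType d') (R : realType).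
Variable q : R.-pker T ~> S.

Definition pair_with (x : T) : {mfun S >-> (T * S)%type} :=
  mfun_Sub (mem_set (measurable_fun_pair (measurable_cst x) (@measurable_id _ S setT))).

(** The law of (x, y) for y drawn from [q x].  The idle [unit] component gives
it the shape required from the second factor of [kcomp]. *)
Definition paired_kernel (x : unit * T) : {measure set (T * S) -> \bar R} :=
  distribution (kernel_law q x.2) (pair_with x.2).

Let measurable_paired_kernel U : measurable U ->
  measurable_fun setT (paired_kernel ^~ U).
Proof.
move=> mU.
have -> : paired_kernel ^~ U = (fun x => q x (xsection U x)) \o snd.
  by apply/funext => x; rewrite /= /paired_kernel /distribution /pushforward xsectionE.
apply: measurableT_comp => //.
by apply: measurable_fun_xsection_finite_kernel; rewrite inE.
Qed.

HB.instance Definition _ := isKernel.Build _ _ _ _ R paired_kernel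
  measurable_paired_kernel.

Let prob_paired_kernel x : paired_kernel x setT = 1%E.
Proof. exact: probability_setT. Qed.

HB.instance Definition _ := Kernel_isProbability.Build _ _ _ _ R paired_kernel
  prob_paired_kernel.

End paired_kernel.

Section disintegration.
Context d d' d0 (Omega : measurableType d0) (T : measurableType d)
  (S : measurableType d') (R : realType).
Variables (P : probability Omega R) (q : R.-pker T ~> S).
Variables (W : {RV P >-> T}) (Y : {RV P >-> S}).
Hypothesis WY : forall A B, measurable A -> measurable B ->
  P (W @^-1` A `&` Y @^-1` B) = (\int[P]_(w in W @^-1` A) q (W w) B)%E.

(** The law of (W, Y) and the composition of the law of W with [paired_kernel q]
agree on rectangles, hence everywhere. *)
Lemma disintegration (f : T * S -> \bar R) : measurable_fun setT f ->
  (forall z, 0 <= f z)%E ->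
  (\int[P]_w f (W w, Y w) = \int[P]_w \int[q (W w)]_y f (W w, y))%E.
Proof.
move=> mf f0.
pose WYf : {RV P >-> (T * S)%type} := mfun_Sub (mem_set
  (measurable_fun_pair (@measurable_funPT _ _ _ _ W) (@measurable_funPT _ _ _ _ Y))).
pose l : R.-pker unit ~> T :=
  kprobability (measurable_cst (distribution P W : pprobability T R)).
pose k : R.-pker (unit * T) ~> (T * S)%type := paired_kernel q.
have mk U : measurable U ->
    measurable_fun setT (fun x : T => kernel_law q x (pair x @^-1` U)).
  move=> mU; change (measurable_fun setT ((k ^~ U) \o (fun x : T => (tt, x)))).
  apply: measurableT_comp; first exact: measurable_kernel.
  exact: measurable_fun_pair.
have mq : measurable_fun setT (fun x : T => \int[q x]_y f (x, y))%E.
  exact: measurable_fun_integral_finite_kernel.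
transitivity (\int[distribution P WYf]_z f z)%E.
  by rewrite ge0_integral_distribution.
transitivity (\int[kcomp l k tt]_z f z)%E.
  apply: eq_measure_integral => A mA _.
  pose G : set (set (T * S)) := [set A `*` B | A in measurable & B in measurable].
  apply: (measure_unique G (fun=> setT)) => //.
  - exact: measurable_prod_measurableType.
  - move=> _ _ [A1 mA1 [B1 mB1 <-]] [A2 mA2 [B2 mB2 <-]].
    exists (A1 `&` A2); first exact: measurableI.
    by exists (B1 `&` B2); [exact: measurableI|rewrite setXI].
  - by move=> _; exists setT => //; exists setT => //; rewrite setXTT.
  - by rewrite bigcup_const.
  - move=> _ [A1 mA1 [B1 mB1 <-]].
    rewrite /distribution /pushforward/=.
    transitivity (P (W @^-1` A1 `&` Y @^-1` B1)); first by [].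
    rewrite WY// /kcomp /l /kprobability/=.
    rewrite [RHS]ge0_integral_distribution//; last by apply: mk; exact: measurableX.
    rewrite integral_mkcond; apply: eq_integral => w _ /=; rewrite patchE /kernel_law.
    case: ifPn => [|/negP WA].
      rewrite inE/= => WA; congr (q _ _).
      by apply/seteqP; split => y //= [].
    rewrite (_ : _ @^-1` _ = set0) ?measure0//.
    by apply/seteqP; split => // y /= [A1w _]; apply: WA; rewrite inE.
  - move=> _; change (distribution P WYf setT < +oo)%E.
    by rewrite probability_setT ltry.

rewrite integral_kcomp//= /l /kprobability/=.
transitivity (\int[distribution P W]_x \int[q x]_y f (x, y))%E.
  by apply: eq_integral => x _; rewrite ge0_integral_distribution.
rewrite ge0_integral_distribution// => x; exact: integral_ge0.
Qed.

End disintegration.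

Section kernel_on_snd.
Context d d' d0 (U : measurableType d0) (T : measurableType d)
  (S : measurableType d') (R : realType).
Variable k : R.-pker T ~> S.

(** A kernel extended to pairs whose first component only records the past. *)
Definition kernel_on_snd (z : U * T) : {measure set S -> \bar R} := k z.2.

Let measurable_kernel_on_snd B : measurable B ->
  measurable_fun setT (kernel_on_snd ^~ B).
Proof.
move=> mB; change (measurable_fun setT ((k ^~ B) \o (@snd U T))).
by apply: measurableT_comp => //; exact: measurable_kernel.
Qed.

HB.instance Definition _ := isKernel.Build _ _ _ _ R kernel_on_snd
  measurable_kernel_on_snd.

HB.instance Definition _ := Kernel_isProbability.Build _ _ _ _ R kernel_on_snd
  (fun z => prob_kernel z.2).

End kernel_on_snd.

(** * Time sets and the Markov property at every lag *)

Section time_sets.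
Variables (R : realType) (K : time_kind).
Implicit Types s t : R.

Lemma times_ge0 t : times R K t -> 0 <= t.
Proof. by case: K => //= /natr_ge0. Qed.

Lemma times0 : times R K 0.
Proof. by case: K => /=; [exact: rpred0|exact: lexx]. Qed.

Lemma timesD s t : times R K s -> times R K t -> times R K (s + t).
Proof. by case: K => /=; [exact: rpredD|exact: addr_ge0]. Qed.

Lemma timesB s t : times R K s -> times R K t -> s <= t -> times R K (t - s).
Proof.
case: K => /=; last by rewrite subr_ge0.
move=> /natrP[m ->] /natrP[n ->]; rewrite ler_nat => mn.
by rewrite -natrB// natr_nat.
Qed.

Lemma lags_times t : lags R K t -> times R K t.
Proof. by case: K => /=; [move=> ->; exact: rpred1|exact: ltW]. Qed.

(** In continuous time every positive time is a lag, and in discrete time this is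
the induction on the number of steps; so what passes from lags to all times can
be proved for both kinds of time at once. *)
Lemma times_ind (Q : R -> Prop) : Q 0 -> (forall t, lags R K t -> Q t) ->
  (forall s t, times R K s -> lags R K t -> Q s -> Q (s + t)) ->
  forall t, times R K t -> Q t.
Proof.
case: K => /= Q0 Ql QD t.
  move=> /natrP[n ->]; elim: n => [|n ih]; first exact: Q0.
  by rewrite -natr1; apply: QD => //; exact: natr_nat.
by rewrite le_eqVlt => /predU1P[<-//|]; exact: Ql.
Qed.

End time_sets.

Section markov_all_lags.
Context (R : realType) d (Omega : measurableType d).
Variables (P : probability Omega R) (K : time_kind).
Variables (p : R -> R.-pker R ~> R) (X : R -> {RV P >-> R}).

Let F := natural_filtration K X.

Definition markov_at (h : R) := forall (s : R) (E : set Omega) (A : set R),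
  times R K s -> F s E -> measurable A ->
  P (E `&` X (s + h) @^-1` A) = (\int[P]_(w in E) p h (X s w) A)%E.

Definition adapted_at (s : R) (U : Omega -> R) :=
  forall A, measurable A -> F s (U @^-1` A).

Lemma filtration_sub (s t : R) : s <= t -> F s `<=` F t.
Proof.
move=> st; apply: sub_sigma_algebra2 => E [u [uT us] uE].
by exists u => //; split=> //; exact: le_trans us st.
Qed.

Lemma filtration_measurable s E : F s E -> measurable E.
Proof.
apply: smallest_sub => //; first exact: sigma_algebra_measurable.
by move=> _ [u _ [A mA <-]]; exact: measurable_funP.
Qed.

Lemma adapted_past (s t : R) : times R K s -> s <= t -> adapted_at t (X s).
Proof.
move=> sT st A mA; apply: sub_gen_smallest; exists s => //.
by exists A => //; rewrite setTI.
Qed.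

Lemma adapted_indic s E : F s E -> adapted_at s (\1_E : Omega -> R).
Proof.
move=> FE A mA.
have := @measurable_indic _ (g_sigma_algebraType _) R setT E FE.
by move=> /(_ (@measurableT _ _) A mA); rewrite setTI.
Qed.

Lemma adapted_pair s (U : Omega -> R) A : times R K s -> adapted_at s U ->
  measurable A -> F s ((fun w => (U w, X s w)) @^-1` A).
Proof.
move=> sT aU mA.
pose G := \bigcup_(u in [set u | times R K u /\ u <= s])
        preimage_set_system setT (X u) measurable.
have mU : measurable_fun [set: g_sigma_algebraType G] U.
  by move=> _ B mB; rewrite setTI; exact: aU.
have mX : measurable_fun [set: g_sigma_algebraType G] (X s).
  by move=> _ B mB; rewrite setTI; exact: (adapted_past sT (lexx s)).
have := measurable_fun_pair mU mX.
by move=> /(_ (@measurableT _ _) A mA); rewrite setTI.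
Qed.

(** The Markov property for functions of the future state, of the present state
and of one variable U of the past. *)
Lemma markov_at_function h s (U : {RV P >-> R}) (f : (R * R) * R -> \bar R) :
  markov_at h -> times R K s -> adapted_at s U ->
  measurable_fun setT f -> (forall z, 0 <= f z)%E ->
  (\int[P]_w f (U w, X s w, X (s + h)%R w) =
   \int[P]_w \int[p h (X s w)]_y f (U w, X s w, y))%E.
Proof.
move=> Mh sT aU mf f0.
pose W : {RV P >-> (R * R)%type} := mfun_Sub (mem_set
  (measurable_fun_pair (@measurable_funPT _ _ _ _ U) (@measurable_funPT _ _ _ _ (X s)))).
apply: (@disintegration _ _ _ _ _ _ _ P (kernel_on_snd (U := R) (p h)) W (X (s + h))) => //.
by move=> A B mA mB; apply: Mh => //; exact: adapted_pair.
Qed.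

End markov_all_lags.

(** One more lag l after h is the conditional expectation of p^l(X_(s + h), A)
at time s, which the property at h computes; U is the indicator of the
conditioning event. *)
Lemma markov_at_times (R : realType) d (Omega : measurableType d)
  (P : probability Omega R) (K : time_kind)
  (p : R -> R.-pker R ~> R) (X : R -> {RV P >-> R}) (h : R) :
  markov_process K p X -> times R K h -> markov_at K p X h.
Proof.
move=> [[p0 pD] Mp]; move: h; apply: times_ind.
- move=> s E A sT FE mA; rewrite addr0.
  have mE := filtration_measurable FE.
  transitivity (\int[P]_(w in E) (\1_(X s @^-1` A) w)%:E)%E.
    rewrite integral_indic//; first by rewrite setIC.
    exact: measurable_funPTI.
  by apply: eq_integral => w _; rewrite p0// diracE indicE.
- by move=> t tl s E A sT FE mA; exact: Mp.
- move=> h l hT lT ih s E A sT FE mA.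
  have mE := filtration_measurable FE.
  rewrite addrA Mp//; [|exact: timesD|]; last first.
    by apply: filtration_sub FE; rewrite lerDl (times_ge0 hT).
  have pE w : p (h + l) (X s w) A = (\int[p h (X s w)]_y p l y A)%E.
    by apply: pD => //; exact: lags_times.
  under [RHS]eq_integral do rewrite pE.
  pose U : {RV P >-> R} := mindic R mE.
  have mpA : measurable_fun setT (fun y => p l y A) by exact: measurable_kernel.
  (* The absolute value makes f nonnegative everywhere; it is the identity on
     the values of the indicator U. *)
  pose f (z : (R * R) * R) := (`|z.1.1|%:E * p l z.2 A)%E.
  have mf : measurable_fun setT f.
    apply: emeasurable_funM; last exact: (measurableT_comp mpA measurable_snd).
    apply/measurable_EFinP; apply: measurableT_comp => //.
    exact: measurableT_comp.
  have f0 z : (0 <= f z)%E by rewrite mule_ge0// lee_fin.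
  have := @markov_at_function _ _ _ P K p X h s U f ih sT (adapted_indic FE) mf f0.
  rewrite !(integral_mkcond E) !epatch_indic => e.
  transitivity (\int[P]_w (`|mindic R mE w|%:E * p l (X (s + h)%R w) A))%E.
    by apply: eq_integral => w _ /=; rewrite muleC ger0_norm ?indicE.
  rewrite e; apply: eq_integral => w _ /=.
  by rewrite /f/= ge0_integralZl//= muleC ger0_norm ?indicE.
Qed.

(** * Monotonicity and increments of iterated kernels *)

Section kernel_orders.
Variable R : realType.
Implicit Types (k : R.-pker R ~> R) (f a b : R -> R).

Lemma kernel_le_expectation k k' x x' a b f :
  measurable_fun setT a -> measurable_fun setT b ->
  (forall y, k x (a @^-1` `]y, +oo[) <= k' x' (b @^-1` `]y, +oo[))%E ->
  nondecreasing_fun f -> (forall y, 0 <= f y) ->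
  (\int[k x]_y (f (a y))%:E <= \int[k' x']_y (f (b y))%:E)%E.
Proof.
move=> ma mb ab fnd f0.
pose A : {RV (kernel_law k x) >-> R} := mfun_Sub (mem_set ma).
pose B : {RV (kernel_law k' x') >-> R} := mfun_Sub (mem_set mb).
exact: (@st_le_expectation _ _ _ _ R (kernel_law k x) (kernel_law k' x') A B ab f fnd f0).
Qed.

(** The response r(z, y) to a move from z to y is stochastically nondecreasing
in z.  It is used for the new state r(z, y) = y and for the descent
r(z, y) = z - y. *)
Definition response_monotone k (r : R * R -> R) := forall f,
  nondecreasing_fun f -> (forall y, 0 <= f y) ->
  nondecreasing_fun (fun z => \int[k z]_y (f (r (z, y)))%:E)%E.

Lemma kernel_monotone_response k : kernel_monotone k -> response_monotone k snd.
Proof.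
move=> km f fnd f0 x y xy; apply: (kernel_le_expectation (a := id) (b := id)) => //.
by move=> z; exact: km.
Qed.

Lemma preimage_shift_tail (x y : R) :
  (fun w : R => w - x) @^-1` `]y, +oo[ = `]x + y, +oo[%classic.
Proof. by apply/seteqP; split=> w; rewrite /= !in_itv/= !andbT; lra. Qed.

(** The increment condition says that y - z is stochastically nonincreasing in z;
z - y > c is the complement of the upper set y - z >= - c. *)
Lemma kernel_increment_response k : kernel_increment k ->
  response_monotone k (fun z => z.1 - z.2).
Proof.
move=> ki f fnd f0 x x' xx'.
have mshift z : measurable_fun setT (fun w : R => w - z) by exact: measurable_funB.
have mdiff z : measurable_fun setT (fun w : R => z - w) by exact: measurable_funB.
apply: (kernel_le_expectation (a := fun w => x - w) (b := fun w => x' - w)) => //.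
move=> y.
pose A : {RV (kernel_law k x') >-> R} := mfun_Sub (mem_set (mshift x')).
pose B : {RV (kernel_law k x) >-> R} := mfun_Sub (mem_set (mshift x)).
have AB u : (ccdf A u <= ccdf B u)%E.
  rewrite /ccdf /distribution /pushforward/= /kernel_law !preimage_shift_tail.
  exact: ki.
have := @st_le_upper_set _ _ _ _ R (kernel_law k x') (kernel_law k x) A B AB `[- y, +oo[%classic.
have comp z : (fun w : R => z - w) @^-1` `]y, +oo[ =
    ~` ((fun w : R => w - z) @^-1` `[(- y), +oo[).
  apply/seteqP; split=> w; rewrite /= !in_itv/= !andbT; first lra.
  by move/negP; rewrite -ltNge; lra.
have kC z (V : set R) : measurable V -> (k z (~` V) = 1 - k z V)%E.
  exact: (@probability_setC _ _ _ (kernel_law k z)).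
have mV z : measurable ((fun w : R => w - z) @^-1` `[(- y), +oo[%classic).
  by rewrite -[X in measurable X]setTI; exact: (mshift z).
move=> le1; rewrite !comp !kC//; apply: leeB => //; apply: le1.
by move=> u v; rewrite /= !in_itv/= !andbT => /le_trans; exact.
Qed.

Let le_dirac (x y : R) (U V : set R) : (U x -> V y) -> (\d_x U <= \d_y V :> \bar R)%E.
Proof.
move=> UV; rewrite !diracE lee_fin ler_nat.
by case: (boolP (x \in U)) => // /set_mem/UV Vy; rewrite mem_set.
Qed.

Section composition.
Variables (K : time_kind) (p : R -> R.-pker R ~> R).
Hypothesis pS : transition_semigroup K p.

Let p_fin_num t x (A : set R) : measurable A -> p t x A \is a fin_num.
Proof. exact: (@fin_num_measure _ _ _ (kernel_law (p t) x)). Qed.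

Let p_fin t x (A : set R) : measurable A -> (p t x A = (fine (p t x A))%:E)%E.
Proof. by move=> mA; rewrite fineK// p_fin_num. Qed.

(** p^(s + t)(x, .) averages under p^s(x, .) the function p^t(y, ]c, oo[), which
is nondecreasing in y. *)
Lemma kernel_monotone_times : stochastically_monotone K p ->
  forall t, times R K t -> kernel_monotone (p t).
Proof.
move=> pm; case: pS => p0 pD; apply: times_ind => [|//|s t sT tl ms] y x x' xx'.
  by rewrite !p0//; apply: le_dirac; rewrite /= !in_itv/= !andbT => /lt_le_trans; exact.
rewrite !pD//; [|exact: lags_times..].
have pE z : (\int[p s z]_u p t u `]y, +oo[%classic =
    \int[p s z]_u (fine (p t u `]y, +oo[%classic))%:E)%E.
  by apply: eq_integral => u _; rewrite -p_fin.
rewrite !pE.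
apply: (kernel_le_expectation (a := id) (b := id)
  (f := fun z => fine (p t z `]y, +oo[%classic))) => //.
- by move=> z; exact: ms.
- move=> u v uv; apply: fine_le; rewrite ?p_fin_num//; exact: pm.
Qed.

(** For x <= x', the increment condition for p^s says that the law p^s(x', .) is
below the law p^s(x, .) shifted by x' - x.  Replace the former by the latter,
which increases the average of the nondecreasing p^t(., ]x' + c, oo[); then
undo the shift, where the increment condition for p^t applies.  The iteration
thus uses the two conditions jointly. *)
Lemma kernel_increment_times : stochastically_monotone K p ->
  increment_condition K p ->
  forall t, times R K t -> kernel_increment (p t).
Proof.
move=> pm pi; case: pS => p0 pD; apply: times_ind => [|//|s t sT tl ms] c x x' xx'.
  by rewrite !p0//; apply: le_dirac; rewrite /= !in_itv/= !andbT; lra.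
rewrite !pD//; [|exact: lags_times..].
have mshift z : measurable_fun setT (fun w : R => w - z) by exact: measurable_funB.
set J := `](x' + c), +oo[%classic.
have mJ : measurable J by exact: measurable_itv.
have fnd z : nondecreasing_fun (fun u => fine (p t (u + z) J)).
  by move=> u v uv; apply: fine_le; rewrite ?p_fin_num//; apply: pm => //; rewrite lerD2r.
apply: (@le_trans _ _ (\int[p s x]_y (fine (p t (y - x + x')%R J))%:E)%E).
  have -> : (\int[p s x']_y p t y J =
      \int[p s x']_y (fine (p t (y - x' + x')%R J))%:E)%E.
    by apply: eq_integral => y _; rewrite subrK -p_fin.
  apply: (kernel_le_expectation (a := fun w => w - x') (b := fun w => w - x)
    (f := fun u => fine (p t (u + x') J))) => //.
  by move=> y; rewrite !preimage_shift_tail; exact: ms.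
apply: ge0_le_integral => //.
- apply/measurable_EFinP; apply: nondecreasing_measurable => // u v uv.
  by apply: fnd; rewrite lerD2r.
- exact: measurable_kernel.
- move=> y _; rewrite -p_fin//.
  have yy : y <= y - x + x' by lra.
  have := pi t tl (x + c - y) _ _ yy.
  have -> : y + (x + c - y) = x + c by lra.
  by have -> : y - x + x' + (x + c - y) = x' + c by lra.
Qed.

End composition.

End kernel_orders.

(** * Averaging a test function over a kernel *)

Lemma bounded_integral d (T : measurableType d) (R : realType)
    (P : probability T R) (g : T -> R) (C : R) : measurable_fun setT g ->
  (forall w, 0 <= g w <= C) ->
  (0 <= \int[P]_w (g w)%:E <= C%:E)%E.
Proof.
move=> mg gC; apply/andP; split.
  by apply: integral_ge0 => w _; rewrite lee_fin; case/andP: (gC w).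
have cE : (\int[P]_w C%:E = C%:E)%E.
  rewrite (integral_cst P measurableT C%:E).
  by rewrite [X in (_ * X)%E](@probability_setT _ _ _ P) mule1.
by rewrite -[leRHS]cE; exact: (@ge0_le_integralT _ _ _ P g (fun=> C)).
Qed.

Section kernel_mean.
Variables (R : realType) (k : R.-pker R ~> R) (r : R * R -> R).
Hypothesis mr : measurable_fun setT r.
Variables (g : R * R -> R) (C : R).
Hypotheses (mg : measurable_fun setT g) (gC : forall z, 0 <= g z <= C).

(** The mean of g(x, r(z, Y)) for Y drawn from [k z], where x is remembered from
the past and z is the present state. *)
Definition kernel_mean (z : R * R) : R :=
  fine (\int[k z.2]_y (g (z.1, r (z.2, y)))%:E)%E.

Let mgr x z : measurable_fun setT (fun y => g (x, r (z, y))).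
Proof.
apply: (measurableT_comp mg); apply: measurable_fun_pair => //.
by apply: (measurableT_comp mr); exact: measurable_fun_pair.
Qed.

Let int_bound x z : (0 <= \int[k z]_y (g (x, r (z, y)))%:E <= C%:E)%E.
Proof. exact: (bounded_integral (kernel_law k z)). Qed.

Lemma kernel_meanE x z :
  ((kernel_mean (x, z))%:E = \int[k z]_y (g (x, r (z, y)))%:E)%E.
Proof.
have /andP[h0 hC] := int_bound x z.
by rewrite fineK// ge0_fin_numE// (le_lt_trans hC) ?ltry.
Qed.

Lemma kernel_mean_bound z : 0 <= kernel_mean z <= C.
Proof. by case: z => x z; rewrite -!lee_fin kernel_meanE. Qed.

Lemma measurable_kernel_mean : measurable_fun setT kernel_mean.
Proof.
apply/measurable_EFinP.
pose f (u : (R * R) * R) := (g (u.1.1, r (u.1.2, u.2)))%:E.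
have -> : EFin \o kernel_mean =
    (fun z => \int[kernel_on_snd (U := R) k z]_y f (z, y))%E.
  by apply/funext => -[x z]; exact: kernel_meanE.
apply: (measurable_fun_integral_finite_kernel f (kernel_on_snd (U := R) k)).
  by move=> u; rewrite lee_fin; case/andP: (gC (u.1.1, r (u.1.2, u.2))).
apply/measurable_EFinP; apply: (measurableT_comp mg); apply: measurable_fun_pair.
  exact: measurableT_comp.
apply: (measurableT_comp mr); apply: measurable_fun_pair => //.
exact: measurableT_comp.
Qed.

Lemma kernel_mean_nondecreasing_fst :
  nondecreasing_fst g -> nondecreasing_fst kernel_mean.
Proof.
move=> gnd z x x' xx'; rewrite -lee_fin !kernel_meanE.
apply: ge0_le_integralT => // y; rewrite gnd// andbT.
by case/andP: (gC (x, r (z, y))).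
Qed.

Lemma kernel_mean_nondecreasing_snd : response_monotone k r ->
  nondecreasing_snd g -> nondecreasing_snd kernel_mean.
Proof.
move=> km gnd x z z' zz'; rewrite -lee_fin !kernel_meanE.
apply: (km (fun y => g (x, y))) => // y.
by case/andP: (gC (x, y)).
Qed.

(** For x <= x' the increment g(x', .) - g(x, .) is nonnegative and
nondecreasing, so that its mean is nondecreasing in z. *)
Lemma kernel_mean_supermodular : response_monotone k r ->
  nondecreasing_fst g -> supermodular g -> supermodular kernel_mean.
Proof.
move=> km gfst gsup x x' z z' xx' zz'.
pose f y := g (x', y) - g (x, y).
have f0 y : 0 <= f y by rewrite subr_ge0; exact: gfst.
have fnd : nondecreasing_fun f.
  by move=> y y' yy'; have := gsup _ _ _ _ xx' yy'; rewrite /f; lra.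
have mf u : measurable_fun setT (fun y => f (r (u, y))).
  exact: measurable_funB.
have split_mean u : (kernel_mean (x', u))%:E =
    ((kernel_mean (x, u))%:E + \int[k u]_y (f (r (u, y)))%:E)%E.
  rewrite !kernel_meanE -ge0_integralD//.
  - by apply: eq_integral => y _; rewrite -EFinD; congr EFin; rewrite /f; lra.
  - by move=> y _; rewrite lee_fin; case/andP: (gC (x, r (u, y))).
  - exact/measurable_EFinP.
  - by move=> y _; rewrite lee_fin.
  - exact/measurable_EFinP.
have le_f := km f fnd f0 _ _ zz'.
rewrite -lee_fin !EFinD (split_mean z) (split_mean z') addeCA leeD2lE//.
by rewrite leeD2l.
Qed.

End kernel_mean.

(** * From bounded to integrable test functions *)

(** Only the differences g2 n - g1 n need to converge to Y2 - Y1 and to be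
dominated by it, not g1 n and g2 n separately. *)
Lemma le_expectation_truncation d (T : measurableType d) (R : realType)
    (P : probability T R) (Y1 Y2 : T -> R) (g1 g2 : nat -> T -> R) (C : nat -> R) :
  finite_mean P Y1 -> finite_mean P Y2 ->
  (forall n, measurable_fun setT (g1 n)) -> (forall n, measurable_fun setT (g2 n)) ->
  (forall n w, 0 <= g1 n w <= C n) -> (forall n w, 0 <= g2 n w <= C n) ->
  (forall n, \int[P]_w (g1 n w)%:E <= \int[P]_w (g2 n w)%:E)%E ->
  (forall n w, `|g2 n w - g1 n w| <= `|Y2 w - Y1 w|) ->
  (forall w, \forall n \near \oo, g2 n w - g1 n w = Y2 w - Y1 w) ->
  ('E_P[Y1] <= 'E_P[Y2])%E.
Proof.
move=> i1 i2 m1 m2 b1 b2 le12 dom lim.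
have gi (g : T -> R) c : measurable_fun setT g -> (forall w, 0 <= g w <= c) ->
    P.-integrable setT (EFin \o g).
  move=> mg gc; apply/integrableP; split; first exact/measurable_EFinP.
  have /andP[_ h] := bounded_integral P mg gc.
  apply: (@le_lt_trans _ _ (\int[P]_w (g w)%:E)%E); last first.
    by rewrite (le_lt_trans h)// ltry.
  rewrite le_eqVlt; apply/orP; left; apply/eqP; apply: eq_integral => w _ /=.
  by rewrite ger0_norm//; case/andP: (gc w).
pose D (w : T) := (Y2 w - Y1 w)%:E.
pose Dn n (w : T) := (g2 n w - g1 n w)%:E.
have iD : P.-integrable setT D by exact: (integrableB measurableT i2 i1).
have mD : measurable_fun setT D by case/integrableP : iD.
have mDn n : measurable_fun setT (Dn n).
  by apply/measurable_EFinP; exact: measurable_funB.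
have cvg_Dn : {ae P, forall w, setT w -> Dn ^~ w @ \oo --> D w}.
  apply/aeW => w _; apply: cvg_near_cst; near=> n.
  by rewrite /Dn /D; congr EFin; near: n; exact: lim.
have dom_Dn : {ae P, forall w n, setT w -> `|Dn n w| <= (abse \o D) w}%E.
  by apply/aeW => w n _; rewrite /= lee_fin.
have [_ _ cvgD] := dominated_convergence measurableT mDn mD cvg_Dn
  (integrable_abse iD) dom_Dn.
suff : (0 <= \int[P]_w D w)%E.
  rewrite unlock /D; under eq_integral do rewrite EFinB.
  by rewrite integralB_EFin// suber_ge0 ?integrable_fin_num.
apply: cvge_ge cvgD; apply: nearW => n /=; rewrite /Dn.
have ig1 := gi _ _ (m1 n) (b1 n); have ig2 := gi _ _ (m2 n) (b2 n).
under eq_integral do rewrite EFinB.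
by rewrite integralB_EFin// suber_ge0 ?integrable_fin_num.
Unshelve. all: by end_near. Qed.

Section truncation.
Context (R : realType).
Implicit Types x y : R.


Definition clamp (n : nat) (x : R) : R :=
  if n%:R < x then n%:R else if x < - n%:R then - n%:R else x.

Lemma clamp_bound n x : - n%:R <= clamp n x <= n%:R.
Proof.
have := ler0n R n; rewrite /clamp.
by repeat (case: ltP => ?); lra.
Qed.

Lemma clamp_step n x y : x <= y -> 0 <= clamp n y - clamp n x <= y - x.
Proof.
move=> xy; have n0 := ler0n R n; rewrite /clamp.
by repeat (case: ltP => ?); apply/andP; split; lra.
Qed.

Lemma nondecreasing_clamp n : nondecreasing_fun (clamp n).
Proof.
by move=> x y xy; have /andP[h _] := clamp_step n xy; move: h; rewrite subr_ge0.
Qed.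

Lemma clamp_dist n x y : `|clamp n x - clamp n y| <= `|x - y|.
Proof.
wlog xy : x y / y <= x.
  by move=> h; have [/ltW/h|/h//] := ltP x y; rewrite distrC (distrC y).
by have /andP[h0 h1] := clamp_step n xy; rewrite !ger0_norm// (le_trans h0 h1).
Qed.

Lemma clamp_id n x : `|x| <= n%:R -> clamp n x = x.
Proof.
rewrite ler_norml => /andP[? ?]; rewrite /clamp.
by repeat (case: ltP => ?); lra.
Qed.

Lemma measurable_clamp n : measurable_fun setT (clamp n).
Proof. exact: nondecreasing_measurable (@nondecreasing_clamp n). Qed.

Lemma near_le_nat (x : R) : \forall n \near \oo, x <= n%:R.
Proof.
exists (Num.truncn x).+1 => // n /= xn.
by apply/ltW/(lt_le_trans (truncnS_gt _)); rewrite ler_nat.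
Qed.
End truncation.

Lemma clamp_shrinks (R : realType) n (x x' : R) : x <= x' ->
  clamp n x = clamp n x' \/ x <= clamp n x /\ clamp n x' <= x'.
Proof.
move=> xx'; have := ler0n R n; rewrite /clamp.
by repeat (case: ltP => ?); first [left; lra | right; lra].
Qed.

(** Monotonicity in x allows x to be clamped on both sides.  As the increments in
x grow with y, y may be cut from above without increasing them, whereas a cut
from below would not be dominated. *)
Lemma truncated_increment_le (R : realType) (h : R * R -> R) n (x x' y : R) :
  supermodular h -> nondecreasing_fst h ->
  `|h (clamp n x', Num.min y n%:R) - h (clamp n x, Num.min y n%:R)| <=
  `|h (x', y) - h (x, y)|.
Proof.
move=> hsup hfst; wlog xx' : x x' / x <= x'.
  by move=> th; have [/th//|/ltW/th] := leP x x'; rewrite distrC (distrC (h (x, y))).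
have yn : Num.min y n%:R <= y by rewrite ge_min lexx.
set y' := Num.min _ _ in yn *.
rewrite ger0_norm ?subr_ge0; last by apply: hfst; exact: nondecreasing_clamp.
rewrite ger0_norm ?subr_ge0; last exact: hfst.
have [->|[xl xr]] := clamp_shrinks n xx'; first by rewrite subrr subr_ge0; exact: hfst.
have := hsup _ _ _ _ xx' yn; have := hfst y' _ _ xl; have := hfst y' _ _ xr; lra.
Qed.

Section bounded_test_functions.
Context d (T : measurableType d) (R : realType) (P : probability T R).
Variables (U1 U2 : {RV P >-> R}).

(** The subtracted term h(- n, min(y, n)) does not change the differences between
two values of x; it makes the truncation nonnegative, and bounded although h is
not truncated from below in y. *)
Lemma le_mean_supermodular (Z : {RV P >-> R}) :
  (forall (g : R * R -> R) (C : R), measurable_fun setT g ->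
     (forall z, 0 <= g z <= C) -> supermodular g -> nondecreasing_fst g ->
     (\int[P]_w (g (U1 w, Z w))%:E <= \int[P]_w (g (U2 w, Z w))%:E)%E) ->
  forall h : R * R -> R, measurable_fun setT h -> supermodular h ->
    nondecreasing_fst h ->
    finite_mean P (fun w => h (U1 w, Z w)) ->
    finite_mean P (fun w => h (U2 w, Z w)) ->
    ('E_P[fun w => h (U1 w, Z w)] <= 'E_P[fun w => h (U2 w, Z w)])%E.
Proof.
move=> le_test h mh hsup hfst i1 i2.
pose g (n : nat) (z : R * R) :=
  h (clamp n z.1, Num.min z.2 n%:R) - h (- n%:R, Num.min z.2 n%:R).
have mmin n : measurable_fun setT (fun z : R * R => Num.min z.2 n%:R).
  by apply: measurable_minr => //; exact: measurable_snd.
have mg n : measurable_fun setT (g n).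
  apply: measurable_funB.
    apply: (measurableT_comp mh); apply: measurable_fun_pair => //.
    by apply: measurableT_comp measurable_fst; exact: measurable_clamp.
  by apply: (measurableT_comp mh); exact: measurable_fun_pair.
have gsup n : supermodular (g n).
  move=> x1 x2 y1 y2 x12 y12; rewrite /g/=.
  have ymin : Num.min y1 n%:R <= Num.min y2 n%:R.
    by rewrite le_min !ge_min y12 lexx orbT.
  by have := hsup _ _ _ _ (nondecreasing_clamp n x12) ymin; lra.
have gfst n : nondecreasing_fst (g n).
  move=> y x1 x2 x12; rewrite /g/=.
  by have := hfst (Num.min y n%:R) _ _ (nondecreasing_clamp n x12); lra.
have gbound n z : 0 <= g n z <= h (n%:R, n%:R) - h (- n%:R, n%:R).
  case: z => x y; have /andP[xn nx] := clamp_bound n x.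
  have yn : Num.min y n%:R <= n%:R by rewrite ge_min lexx orbT.
  rewrite /g/= subr_ge0 hfst//=.
  have := hsup _ _ _ _ (le_trans xn nx) yn; have := hfst (Num.min y n%:R) _ _ nx.
  lra.
apply: (@le_expectation_truncation _ _ R P _ _
  (fun n w => g n (U1 w, Z w)) (fun n w => g n (U2 w, Z w))
  (fun n => h (n%:R, n%:R) - h (- n%:R, n%:R))) => //.
- by move=> n; apply: (measurableT_comp (mg n)); exact: measurable_fun_pair.
- by move=> n; apply: (measurableT_comp (mg n)); exact: measurable_fun_pair.
- by move=> n; apply: le_test => //; exact: gbound.
- move=> n w; rewrite /g/=.
  set x := U1 w; set x' := U2 w; set y := Z w.
  rewrite (_ : _ - _ - _ =
    h (clamp n x', Num.min y n%:R) - h (clamp n x, Num.min y n%:R)); last lra.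
  exact: truncated_increment_le.
- move=> w; near=> n; rewrite /g/=.
  rewrite !clamp_id; [|near: n; exact: near_le_nat..].
  rewrite (_ : Num.min _ _ = Z w); last by apply/min_idPl; near: n; exact: near_le_nat.
  lra.
Unshelve. all: end_near. Qed.

(** Clamping the values of h preserves monotonicity in each variable, which is
all that is asked here. *)
Lemma le_mean_nondecreasing (V1 V2 : {RV P >-> R}) :
  (forall (g : R * R -> R) (C : R), measurable_fun setT g ->
     (forall z, 0 <= g z <= C) -> nondecreasing_fst g -> nondecreasing_snd g ->
     (\int[P]_w (g (U1 w, V1 w))%:E <= \int[P]_w (g (U2 w, V2 w))%:E)%E) ->
  forall h : R * R -> R, measurable_fun setT h ->
    nondecreasing_fst h -> nondecreasing_snd h ->
    finite_mean P (fun w => h (U1 w, V1 w)) ->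
    finite_mean P (fun w => h (U2 w, V2 w)) ->
    ('E_P[fun w => h (U1 w, V1 w)] <= 'E_P[fun w => h (U2 w, V2 w)])%E.
Proof.
move=> le_test h mh hfst hsnd i1 i2.
pose g (n : nat) (z : R * R) := clamp n (h z) + n%:R.
have mg n : measurable_fun setT (g n).
  by apply: measurable_funD => //; apply: measurableT_comp mh; exact: measurable_clamp.
have gbound n z : 0 <= g n z <= n%:R + n%:R.
  by rewrite /g; have /andP[] := clamp_bound n (h z); lra.
apply: (@le_expectation_truncation _ _ R P _ _
  (fun n w => g n (U1 w, V1 w)) (fun n w => g n (U2 w, V2 w))
  (fun n => n%:R + n%:R)) => //.
- by move=> n; apply: (measurableT_comp (mg n)); exact: measurable_fun_pair.
- by move=> n; apply: (measurableT_comp (mg n)); exact: measurable_fun_pair.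
- move=> n; apply: (le_test _ (n%:R + n%:R)) => //.
  + by move=> y x x' xx'; rewrite lerD2r; apply/nondecreasing_clamp/hfst.
  + by move=> x y y' yy'; rewrite lerD2r; apply/nondecreasing_clamp/hsnd.
- by move=> n w; rewrite /g opprD addrACA subrr addr0; exact: clamp_dist.
- move=> w; near=> n; rewrite /g opprD addrACA subrr addr0 !clamp_id//; near: n; exact: near_le_nat.
Unshelve. all: end_near. Qed.

End bounded_test_functions.

(** * Comparisons along the process *)

(** Integrate g(U, V) + phi(V) <= g(V, V) + phi(U) for a potential phi. *)
Lemma supermodular_rearrangement d (T : measurableType d) (R : realType)
    (P : probability T R) (U V : {RV P >-> R}) (g : R * R -> R) (C : R) :
  st_le U V -> measurable_fun setT g -> (forall z, 0 <= g z <= C) ->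
  supermodular g -> nondecreasing_fst g ->
  (\int[P]_w (g (U w, V w))%:E <= \int[P]_w (g (V w, V w))%:E)%E.
Proof.
move=> UV mg gC gsup gfst.
have [phi [phind phiC phiP]] := supermodular_potential gsup gfst gC.
have mphi : measurable_fun setT phi by exact: nondecreasing_measurable.
have mphiX (X : {RV P >-> R}) : measurable_fun setT (phi \o X).
  exact: measurableT_comp.
have mgX (X Y : {RV P >-> R}) : measurable_fun setT (fun w => g (X w, Y w)).
  by apply: (measurableT_comp mg); exact: measurable_fun_pair.
have phi0 x : 0 <= phi x by case/andP: (phiC x).
have g0 z : 0 <= g z by case/andP: (gC z).
have phi_le : (\int[P]_w (phi (U w))%:E <= \int[P]_w (phi (V w))%:E)%E.
  exact: st_le_expectation.
have phi_fin : (\int[P]_w (phi (V w))%:E)%E \is a fin_num.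
  have /andP[l u] := bounded_integral P (mphiX V) (fun w => phiC (V w)).
  by rewrite ge0_fin_numE// (le_lt_trans u)// ltry.
rewrite -(leeD2rE _ _ phi_fin); apply: le_trans (leeD2l _ phi_le).
have addE (f f' : T -> R) : measurable_fun setT f -> measurable_fun setT f' ->
    (forall w, 0 <= f w) -> (forall w, 0 <= f' w) ->
    (\int[P]_w (f w)%:E + \int[P]_w (f' w)%:E = \int[P]_w (f w + f' w)%:E)%E.
  move=> mf mf' f0 f'0; under [RHS]eq_integral do rewrite EFinD.
  rewrite ge0_integralD//.
  - by move=> w _; rewrite lee_fin.
  - exact/measurable_EFinP.
  - by move=> w _; rewrite lee_fin.
  - exact/measurable_EFinP.
rewrite (addE _ _ (mgX U V) (mphiX V) (fun=> g0 _) (fun=> phi0 _)).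
rewrite (addE _ _ (mgX V V) (mphiX U) (fun=> g0 _) (fun=> phi0 _)).
apply: (@ge0_le_integralT _ _ _ P (fun w => g (U w, V w) + phi (V w))
  (fun w => g (V w, V w) + phi (U w))).
- exact: (measurable_funD (mgX U V) (mphiX V)).
- exact: (measurable_funD (mgX V V) (mphiX U)).
- move=> w; rewrite addr_ge0//=.
  by have := phiP (U w) (V w); lra.
Qed.

Section process.
Context (R : realType) d (Omega : measurableType d).
Variables (P : probability Omega R) (K : time_kind).
Variables (p : R -> R.-pker R ~> R) (X : R -> {RV P >-> R}).
Hypotheses (X_markov : markov_process K p X)
  (p_monotone : stochastically_monotone K p)
  (X0_le : forall t, times R K t -> {ae P, forall w, X 0 w <= X t w}).

Let pS := markov_semigroup X_markov.

(** X_s and X_t are obtained from X_0 and from X_(t - s) by running p^s. *)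
Lemma markov_st_le s t : times R K s -> times R K t -> s <= t ->
  st_le (X s) (X t).
Proof.
move=> sT tT st y; rewrite /ccdf /distribution /pushforward.
have uT : times R K (t - s) by exact: timesB.
have marginal v : times R K v ->
    (P (X (v + s)%R @^-1` `]y, +oo[) = \int[P]_w p s (X v w) `]y, +oo[%classic)%E.
  move=> vT; rewrite -[X in P X]setTI (markov_at_times X_markov sT)//.
  exact: (@measurableT _ (g_sigma_algebraType _)).
have mk v : measurable_fun setT (fun w => p s (X v w) `]y, +oo[%classic).
  by apply: (measurableT_comp (measurable_kernel (p s) _ _)); [exact: measurable_itv|].
have := marginal _ (times0 R K); have := marginal _ uT.
rewrite add0r subrK => -> ->.
apply: ae_ge0_le_integral => //.
apply: filterS (X0_le uT) => w Xw _.
exact: (kernel_monotone_times pS p_monotone sT).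
Qed.

Lemma markov_kernel_mean u s h (r g : R * R -> R) C :
  times R K u -> times R K s -> times R K h -> u <= s ->
  measurable_fun setT r -> measurable_fun setT g -> (forall z, 0 <= g z <= C) ->
  (\int[P]_w (g (X u w, r (X s w, X (s + h)%R w)))%:E =
   \int[P]_w (kernel_mean (p h) r g (X u w, X s w))%:E)%E.
Proof.
move=> uT sT hT us mr mg gC.
pose f (z : (R * R) * R) := (g (z.1.1, r (z.1.2, z.2)))%:E.
have mf : measurable_fun setT f.
  apply/measurable_EFinP; apply: (measurableT_comp mg); apply: measurable_fun_pair.
    exact: measurableT_comp.
  apply: (measurableT_comp mr); apply: measurable_fun_pair => //.
  exact: measurableT_comp.
have f0 z : (0 <= f z)%E by rewrite lee_fin; case/andP: (gC (z.1.1, r (z.1.2, z.2))).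
rewrite (markov_at_function (markov_at_times X_markov hT) sT (adapted_past uT us) mf f0).
by apply: eq_integral => w _; rewrite (kernel_meanE (p h) mr mg gC).
Qed.

(** Both means are conditioned on the past up to s2, the later of the two times,
and not each on its own: the past variable X_s1 is then compared with the
present X_s2 in front of one and the same function. *)
Lemma le_mean_bounded_supermodular s1 s2 t (g : R * R -> R) C :
  times R K s1 -> times R K s2 -> times R K t -> s1 <= s2 -> s2 <= t ->
  measurable_fun setT g -> (forall z, 0 <= g z <= C) ->
  supermodular g -> nondecreasing_fst g ->
  (\int[P]_w (g (X s1 w, X t w))%:E <= \int[P]_w (g (X s2 w, X t w))%:E)%E.
Proof.
move=> s1T s2T tT s12 s2t mg gC gsup gfst.
have hT := timesB s2T tT s2t.
have km := kernel_monotone_response (kernel_monotone_times pS p_monotone hT).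
have mean u : times R K u -> u <= s2 ->
    (\int[P]_w (g (X u w, X t w))%:E =
     \int[P]_w (kernel_mean (p (t - s2)) snd g (X u w, X s2 w))%:E)%E.
  move=> uT us.
  have := markov_kernel_mean uT s2T hT us measurable_snd mg gC.
  by rewrite addrC subrK.
rewrite !mean//; apply: (supermodular_rearrangement (C := C)).
- exact: markov_st_le.
- exact: measurable_kernel_mean.
- exact: kernel_mean_bound.
- exact: (kernel_mean_supermodular measurable_snd mg gC km gfst gsup).
- exact: (kernel_mean_nondecreasing_fst (p (t - s2)) measurable_snd mg gC gfst).
Qed.

Lemma le_mean_bounded_nondecreasing s1 s2 t (g : R * R -> R) C :
  times R K s1 -> times R K s2 -> times R K t -> s1 <= s2 ->
  measurable_fun setT g -> (forall z, 0 <= g z <= C) ->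
  nondecreasing_fst g -> nondecreasing_snd g ->
  (\int[P]_w (g (X s1 w, X (s1 + t)%R w))%:E <=
   \int[P]_w (g (X s2 w, X (s2 + t)%R w))%:E)%E.
Proof.
move=> s1T s2T tT s12 mg gC gfst gsnd.
have km := kernel_monotone_response (kernel_monotone_times pS p_monotone tT).
have mean s (sT : times R K s) :=
  markov_kernel_mean sT sT tT (lexx s) measurable_snd mg gC.
rewrite (mean _ s1T) (mean _ s2T).
pose f x := kernel_mean (p t) snd g (x, x).
apply: (@st_le_expectation _ _ _ _ R P P (X s1) (X s2) _ f).
- exact: markov_st_le.
- move=> x y xy; rewrite /f; apply: (@le_trans _ _ (kernel_mean (p t) snd g (y, x))).
    exact: (kernel_mean_nondecreasing_fst (p t) measurable_snd mg gC gfst).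
  exact: (kernel_mean_nondecreasing_snd measurable_snd mg gC km gsnd).
- by move=> x; case/andP: (kernel_mean_bound (p t) measurable_snd mg gC (x, x)).
Qed.

Let measurable_diff : measurable_fun setT (fun z : R * R => z.1 - z.2).
Proof. exact: measurable_funB. Qed.

Lemma le_mean_bounded_supermodular_incr s1 s2 t e (g : R * R -> R) C :
  increment_condition K p ->
  times R K s1 -> times R K s2 -> times R K t -> times R K e ->
  s1 <= s2 -> s2 <= t ->
  measurable_fun setT g -> (forall z, 0 <= g z <= C) ->
  supermodular g -> nondecreasing_fst g ->
  (\int[P]_w (g (X s1 w, (X t w - X (t + e) w)%R))%:E <=
   \int[P]_w (g (X s2 w, (X t w - X (t + e) w)%R))%:E)%E.
Proof.
move=> p_incr s1T s2T tT eT s12 s2t mg gC gsup gfst.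
have km := kernel_increment_response
  (kernel_increment_times pS p_monotone p_incr eT).
rewrite (markov_kernel_mean s1T tT eT (le_trans s12 s2t) measurable_diff mg gC).
rewrite (markov_kernel_mean s2T tT eT s2t measurable_diff mg gC).
apply: (le_mean_bounded_supermodular s1T s2T tT s12 s2t).
- exact: (measurable_kernel_mean (p e) measurable_diff mg gC).
- exact: (kernel_mean_bound (p e) measurable_diff mg gC).
- exact: (kernel_mean_supermodular measurable_diff mg gC km gfst gsup).
- exact: (kernel_mean_nondecreasing_fst (p e) measurable_diff mg gC gfst).
Qed.

Lemma le_mean_bounded_nondecreasing_incr s1 s2 t e (g : R * R -> R) C :
  increment_condition K p ->
  times R K s1 -> times R K s2 -> times R K t -> times R K e -> s1 <= s2 ->
  measurable_fun setT g -> (forall z, 0 <= g z <= C) ->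
  nondecreasing_fst g -> nondecreasing_snd g ->
  (\int[P]_w (g (X s1 w, (X (s1 + t) w - X (s1 + t + e) w)%R))%:E <=
   \int[P]_w (g (X s2 w, (X (s2 + t) w - X (s2 + t + e) w)%R))%:E)%E.
Proof.
move=> p_incr s1T s2T tT eT s12 mg gC gfst gsnd.
have km := kernel_increment_response
  (kernel_increment_times pS p_monotone p_incr eT).
have le_st s : s <= s + t by rewrite lerDl (times_ge0 tT).
have mean s (sT : times R K s) :=
  markov_kernel_mean sT (timesD sT tT) eT (le_st s) measurable_diff mg gC.
rewrite (mean _ s1T) (mean _ s2T).
apply: (le_mean_bounded_nondecreasing s1T s2T tT s12).
- exact: (measurable_kernel_mean (p e) measurable_diff mg gC).
- exact: (kernel_mean_bound (p e) measurable_diff mg gC).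
- exact: (kernel_mean_nondecreasing_fst (p e) measurable_diff mg gC gfst).
- exact: (kernel_mean_nondecreasing_snd measurable_diff mg gC km gsnd).
Qed.

End process.

(** * Concavity from nonincreasing increments *)

Section concavity.
Variable R : realType.

(** The increment at k bounds the mean slope before k from below, and the mean
slope after k from above. *)
Lemma concave_seq_chord (c : nat -> R) :
  (forall i j, (i <= j)%N -> c j.+1 - c j <= c i.+1 - c i) ->
  forall n k, (k <= n)%N -> k%:R * (c n - c 0%N) <= n%:R * (c k - c 0%N).
Proof.
move=> cc n k /subnKC <-; set m := (n - k)%N; pose e := c k.+1 - c k.
have left j : (j <= k)%N -> j%:R * e <= c j - c 0%N.
  elim: j => [|j ih] jk; first by rewrite mul0r subrr.
  have := ih (ltnW jk); have := cc _ _ (ltnW jk).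
  by rewrite -natr1 -/e; lra.
have right j : c (k + j)%N - c k <= j%:R * e.
  elim: j => [|j ih]; first by rewrite addn0 mul0r subrr.
  by have := cc _ _ (leq_addr j k); rewrite addnS -natr1 -/e; lra.
have h1 := ler_wpM2l (ler0n R m) (left k (leqnn k)).
have h2 := ler_wpM2l (ler0n R k) (right m).
rewrite natrD; lra.
Qed.

Variable a : R -> R.
Hypothesis a_incr : forall s t e, 0 <= s -> s <= t -> 0 < e ->
  a (t + e) - a t <= a (s + e) - a s.
Hypothesis a_nd : forall s t, 0 <= s -> s <= t -> a s <= a t.

Let chord_rational u v n k : 0 <= u -> u < v -> (0 < n)%N -> (k <= n)%N ->
  a u + k%:R / n%:R * (a v - a u) <= a (u + k%:R / n%:R * (v - u)).
Proof.
move=> u0 uv n0 kn; have n0' : 0 < n%:R :> R by rewrite ltr0n.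
pose e := (v - u) / n%:R.
have e0 : 0 < e by rewrite divr_gt0// subr_gt0.
pose c j := a (u + j%:R * e).
have cc i j : (i <= j)%N -> c j.+1 - c j <= c i.+1 - c i.
  move=> ij; rewrite /c -!natr1 !mulrDl !mul1r !addrA; apply: a_incr => //.
    by rewrite addr_ge0// mulr_ge0// ltW.
  by rewrite lerD2l ler_wpM2r ?ler_nat// ltW.
have := concave_seq_chord cc kn.
have cn : c n = a v by rewrite /c /e mulrC divfK ?gt_eqF// addrC subrK.
have c0 : c 0%N = a u by rewrite /c mul0r addr0.
have ck : c k = a (u + k%:R / n%:R * (v - u)) by rewrite /c /e mulrCA [in RHS]mulrC.
rewrite cn c0 ck => h.
rewrite addrC -lerBrDr mulrAC ler_pdivrMr// mulrC [leRHS]mulrC; lra.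
Qed.

Let chord u v l : 0 <= u -> u <= v -> 0 <= l <= 1 ->
  a u + l * (a v - a u) <= a (u + l * (v - u)).
Proof.
move=> u0; rewrite le_eqVlt => /predU1P[<-|uv] /andP[l0 l1].
  by rewrite !subrr !mulr0 !addr0.
have luv : u <= u + l * (v - u) by rewrite lerDl mulr_ge0// subr_ge0 ltW.
have auv := a_nd u0 (ltW uv); rewrite leNgt; apply/negP => lt_chord.
have au := a_nd u0 luv.
have avu : 0 < a v - a u.
  by rewrite subr_gt0 lt_neqAle auv andbT; apply/eqP => e; move: lt_chord au; rewrite e subrr; lra.
pose m := (a (u + l * (v - u)) - a u) / (a v - a u).
have ml : m < l by rewrite ltr_pdivrMr//; lra.
have [n] := ltr_add_invr ml; set N := n.+1 => mN.
have N0 : 0 < N%:R :> R by rewrite ltr0n.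
pose k := Num.truncn (l * N%:R).
have /andP[kl lk] : k%:R <= l * N%:R < k.+1%:R.
  by apply: truncn_itv; rewrite mulr_ge0// ltW.
have kN : (k <= N)%N.
  by rewrite -(ler_nat R) (le_trans kl)// ler_piMl// ltW.
have kl' : k%:R / N%:R <= l by rewrite ler_pdivrMr.
have mk : m < k%:R / N%:R.
  rewrite ltr_pdivlMr//.
  have : (m + N%:R^-1) * N%:R < l * N%:R by rewrite ltr_pM2r.
  by rewrite mulrDl mulVf ?gt_eqF//; move: lk; rewrite -natr1; lra.
have := chord_rational u0 uv (isT : (0 < N)%N) kN.
have : a (u + k%:R / N%:R * (v - u)) <= a (u + l * (v - u)).
  apply: a_nd; first by rewrite addr_ge0// mulr_ge0// ?divr_ge0// subr_ge0 ltW.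
  by rewrite lerD2l ler_wpM2r// subr_ge0 ltW.
move: mk; rewrite ltr_pdivrMr//; lra.
Qed.

(** A violation of the chord inequality at u + l (v - u) would persist for
rational ratios slightly below l, because a is nondecreasing; but
equal subdivisions of [u, v] give the inequality at rational ratios. *)
Lemma concave_of_increments :
  convex_function (times R continuous_time) (fun t => - a t).
Proof.
have key (l x y : R) : 0 <= l -> l <= 1 -> 0 <= x -> 0 <= y ->
    - a (l * x + (1 - l) * y) <= l * (- a x) + (1 - l) * (- a y).
  move=> l0 l1 x0 y0.
  have [xy|/ltW yx] := leP x y.
    have l01 : 0 <= 1 - l <= 1 by apply/andP; split; lra.
    have := chord x0 xy l01.
    by rewrite (_ : x + _ = l * x + (1 - l) * y); lra.
  have := chord y0 yx (introT andP (conj l0 l1)).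
  by rewrite (_ : y + _ = l * x + (1 - l) * y); lra.
by move=> l x y; rewrite !inE/= => x0 y0; exact: key.
Qed.

End concavity.

(** * The monotonicity and concavity theorem *)

Theorem theorem5 (R : realType) (d : measure_display)
    (Omega : measurableType d) (P : probability Omega R)
    (K : time_kind) (p : R -> R.-pker R ~> R) (X : R -> {RV P >-> R})
    (X_markov : markov_process K p X)
    (p_monotone : stochastically_monotone K p)
    (X0_le : forall t : R, times R K t ->
       {ae P, forall w, X 0 w <= X t w}) :
  [/\
   (* (i) *)
   forall s t : R, times R K s -> times R K t -> s <= t ->
     st_le (X s) (X t),
   (* (ii) *)
   forall h : R * R -> R, measurable_fun setT h -> supermodular h ->
     nondecreasing_fst h ->
     (forall t : R, times R K t ->
        nondecreasing_mean P [set s | times R K s /\ s <= t]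
          (fun s w => h (X s w, X t w))) /\
     (increment_condition K p ->
      forall t delta : R, times R K t -> times R K delta -> 0 < delta ->
        nondecreasing_mean P [set s | times R K s /\ s <= t]
          (fun s w => h (X s w, X t w - X (t + delta) w))),
   (* (iii) *)
   forall h : R * R -> R, measurable_fun setT h ->
     nondecreasing_fst h -> nondecreasing_snd h ->
     (forall t : R, times R K t ->
        nondecreasing_mean P (times R K)
          (fun s w => h (X s w, X (t + s) w))) /\
     (increment_condition K p ->
      forall t delta : R, times R K t -> times R K delta -> 0 < delta ->
        nondecreasing_mean P (times R K)
          (fun s w => h (X s w, X (s + t) w - X (s + t + delta) w)))
   (* (iv) *)
   & (forall t : R, times R K t -> finite_mean P (X t)) ->
     (forall s t : R, times R K s -> times R K t -> s <= t ->
        ('E_P[X s] <= 'E_P[X t])%E) /\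
     (increment_condition K p ->
      concave_in_time K (fun t => fine 'E_P[X t]))].
Proof.
pose Z s e : {RV P >-> R} := mfun_Sub (mem_set (measurable_funB
  (@measurable_funPT _ _ _ _ (X s)) (@measurable_funPT _ _ _ _ (X (s + e))))).
have iii (h : R * R -> R) : measurable_fun setT h ->
    nondecreasing_fst h -> nondecreasing_snd h -> forall t : R, times R K t ->
    nondecreasing_mean P (times R K) (fun s w => h (X s w, X (t + s) w)).
  move=> mh hfst hsnd t tT s1 s2 s1T s2T s12.
  apply: le_mean_nondecreasing => // g C mg gC gfst gsnd; rewrite ![t + _]addrC.
  exact: (le_mean_bounded_nondecreasing X_markov p_monotone X0_le s1T s2T tT s12 mg gC).
have iii_incr (h : R * R -> R) : increment_condition K p -> measurable_fun setT h ->
    nondecreasing_fst h -> nondecreasing_snd h ->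
    forall t delta : R, times R K t -> times R K delta -> 0 < delta ->
    nondecreasing_mean P (times R K)
      (fun s w => h (X s w, X (s + t) w - X (s + t + delta) w)).
  move=> p_incr mh hfst hsnd t e tT eT _ s1 s2 s1T s2T s12.
  apply: (@le_mean_nondecreasing _ _ _ P (X s1) (X s2) (Z (s1 + t) e) (Z (s2 + t) e))
    => // g C mg gC gfst gsnd.
  exact: (le_mean_bounded_nondecreasing_incr X_markov p_monotone X0_le p_incr
    s1T s2T tT eT s12 mg gC).
split => //.
- exact: markov_st_le X_markov p_monotone X0_le.
- move=> h mh hsup hfst; split=> [t tT|p_incr t e tT eT _] s1 s2 [s1T _] [s2T s2t] s12.
    apply: le_mean_supermodular => // g C mg gC gsup gfst.
    exact: (le_mean_bounded_supermodular X_markov p_monotone X0_le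
      s1T s2T tT s12 s2t mg gC).
  apply: (@le_mean_supermodular _ _ _ P (X s1) (X s2) (Z t e)) => // g C mg gC gsup gfst.
  exact: (le_mean_bounded_supermodular_incr X_markov p_monotone X0_le p_incr
    s1T s2T tT eT s12 s2t mg gC).
- by move=> h mh hfst hsnd; split; [exact: iii|move=> p_incr; exact: iii_incr].
- move=> fX.
  have nd_fst : nondecreasing_fst (@fst R R) by move=> ? ? ?.
  have nd_snd : nondecreasing_snd (@snd R R) by move=> ? ? ?.
  have cst_fst : nondecreasing_snd (@fst R R) by move=> ? ? ? _ /=.
  have cst_snd : nondecreasing_fst (@snd R R) by move=> ? ? ? _ /=.
  have mean_nd s t : times R K s -> times R K t -> s <= t -> ('E_P[X s] <= 'E_P[X t])%E.
    move=> sT tT st.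
    exact: (iii fst measurable_fst nd_fst cst_fst 0 (times0 R K) s t sT tT st (fX _ sT) (fX _ tT)).
  split=> // p_incr.
  have fin t : times R K t -> ('E_P[X t])%E \is a fin_num.
    by move=> tT; rewrite unlock; exact: (integrable_fin_num measurableT (fX _ tT)).
  have incr s t e : times R K s -> times R K t -> times R K e -> s <= t -> 0 < e ->
      fine 'E_P[X (t + e)] - fine 'E_P[X t] <= fine 'E_P[X (s + e)] - fine 'E_P[X s].
    move=> sT tT eT st e0.
    have fdiff u : times R K u -> finite_mean P (fun w => X u w - X (u + e) w).
      by move=> uT; exact: (integrableB measurableT (fX _ uT) (fX _ (timesD uT eT))).
    have mean_diff u : times R K u -> ('E_P[fun w => (X u w - X (u + e) w)%R] =
        (fine 'E_P[X u] - fine 'E_P[X (u + e)%R])%:E)%E.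
      move=> uT; rewrite EFinB !fineK ?fin//; last exact: timesD.
      rewrite unlock; under eq_integral do rewrite EFinB.
      by rewrite (integralB_EFin measurableT (fX _ uT) (fX _ (timesD uT eT))).
    have := iii_incr snd p_incr measurable_snd cst_snd nd_snd 0 e (times0 R K) eT e0
      s t sT tT st.
    rewrite /= !addr0 => /(_ (fdiff _ sT) (fdiff _ tT)).
    rewrite (mean_diff _ sT) (mean_diff _ tT) lee_fin; lra.
  case: K fX incr mean_nd fin {X_markov p_monotone X0_le iii iii_incr p_incr} => fX incr mean_nd fin /=.
    by move=> s t sT tT st; apply: incr => //; exact: rpred1.
  apply: concave_of_increments => [s t e s0 st e0|s t s0 st].
    by apply: incr => //=; [exact: le_trans st|exact: ltW].
  have t0 := le_trans s0 st.
  by apply: fine_le; rewrite ?fin//; exact: mean_nd.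
Qed.
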